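(* Assume that the penalty parameters satisfy $$\beta_{\ell}>L\,L_{\bar{\mathcal O}}\,\max\{\theta_w,1\}^{L}+2\sum_{j=\ell+1}^L\beta_j\,\theta_w\max\{\theta_w,1\}^{j-\ell-1}\quad\text{for all }\ell\in[L].$$ Then the following statements hold. (a) $(w^*,b^*,v^*,u^* )$ is a global minimizer of problem (PP) if and only if $(w^*,b^*,v^*,u^* )$ is a global minimizer of problem (P). (b) If $(w^*,b^*,v^*,u^* )\in\{(w,b,v,u)\in\Omega_2:\mathcal O(w,v,u)<\theta\}$ is a local minimizer of problem (PP), then $(w^*,b^*,v^*,u^* )$ is also a local minimizer of problem (P). (c) A point $(w^*,b^*,v^*,u^* )\in\{(w,b,v,u)\in\Omega_1:\mathcal O(w,v,u)<\theta\}$ is a local minimizer of problem (P) if and only if $(w^*,b^*,v^*,u^* )$ is a local minimizer of problem (PP).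
   Context: Setting. $[K]=\{1,\dots,K\}$; $\|\cdot\|$ is the Euclidean norm. $L,N,N_0,\dots,N_L$ are positive integers, $x_n\in\mathbb R^{N_0}$ and $y_n\in\mathbb R^{N_L}$ ($n\in[N]$) are given data, $Y=(y_1,\dots,y_N)$, and $0<\alpha<1$, $\lambda_w>0$, $\lambda_v>0$, $\beta_\ell>0$ ($\ell\in[L]$) are constants. $\sigma(z)=\max\{z,\alpha z\}$ componentwise. Variables. $W_\ell\in\mathbb R^{N_\ell\times N_{\ell-1}}$, $b_\ell\in\mathbb R^{N_\ell}$, $v_{n,\ell},u_{n,\ell}\in\mathbb R^{N_\ell}$ for $\ell\in[L]$, $n\in[N]$, with $v_{n,0}:=x_n$. Put $\widetilde N=\sum_{\ell=1}^LN_\ell N_{\ell-1}$, $\overline N=\sum_{\ell=1}^LN_\ell$, $m=N\overline N$. The vectors $w\in\mathbb R^{\widetilde N}$ (stacking the column-wise vectorizations of $W_1,\dots,W_L$), $b\in\mathbb R^{\overline N}$ (stacking $b_1,\dots,b_L$), and $v,u\in\mathbb R^m$ (stacking $v_{n,\ell}$, resp. $u_{n,\ell}$, in the order $(1,1),(2,1),\dots,(N,1),(1,2),\dots,(N,L)$ of $(n,\ell)$) collect the variables. The linear-in-$w$ map $\Psi(v)w$ and the matrix $A\in\mathbb R^{m\times\overline N}$ are such that $\Psi(v)w+Ab$ has $(n,\ell)$ block $W_\ell v_{n,\ell-1}+b_\ell$; that is, $\Psi(v)$ is block diagonal with blocks $V_{\ell-1}^\top\otimes I_{N_\ell}$, where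 $V_\ell=(v_{1,\ell},\dots,v_{N,\ell})$, $V_0=(x_1,\dots,x_N)$, and $A$ is block diagonal with blocks $e_N\otimes I_{N_\ell}$ ($e_K$ is the all-ones vector in $\mathbb R^K$). Objective. $\mathcal R_1(w)=\lambda_w\sum_{\ell=1}^L\sum_{j=1}^{N_{\ell-1}}\|(W_\ell)_{\cdot,j}\|$ (with $(W_\ell)_{\cdot,j}$ the $j$-th column), $\mathcal R_2(v)=\lambda_v\|v\|^2$, $\bar{\mathcal O}(w,v)=\frac1N\sum_{n=1}^N\|v_{n,L}-y_n\|^2+\mathcal R_1(w)+\mathcal R_2(v)$. With $\beta=(\beta_1e_{NN_1}^\top,\dots,\beta_Le_{NN_L}^\top)^\top\in\mathbb R^m$, $\mathcal O(w,v,u)=\bar{\mathcal O}(w,v)+\beta^\top(v-\sigma(u))$. Problem (P): minimize $\bar{\mathcal O}(w,v)$ over $\Omega_1=\{(w,b,v,u): v=\sigma(u),\ u=\Psi(v)w+Ab\}$. Problem (PP): minimize $\mathcal O(w,v,u)$ over $\Omega_2=\{(w,b,v,u): v-u\ge0,\ v-\alpha u\ge 0,\ u=\Psi(v)w+Ab\}$. Constants. $\theta>\frac1N\|Y\|_F^2$ is fixed; $\Omega_\theta=\{(w,b,v,u)\in\Omega_2:\mathcal O(w,v,u)\le\theta\}$; $\theta_w=\frac{\theta}{\lambda_w}\sqrt{\overline N+N_0}$ (an upper bound for $\|w\|$ on $\Omega_\theta$); $L_{\bar{\mathcal O}}$ is the Lipschitz constant of $\bar{\mathcal O}$ over $\Omega_\theta$.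 *)

(* Defs.v *)
From HB Require Import structures.
From mathcomp Require Import all_boot all_order all_algebra.
From mathcomp Require Import all_classical all_reals all_analysis.
Import Order.TTheory GRing.Theory Num.Theory.
Import numFieldNormedType.Exports.

Set Implicit Arguments.
Unset Strict Implicit.
Unset Printing Implicit Defensive.

Local Open Scope classical_set_scope.
Local Open Scope ring_scope.

(* Frobenius norm; on column vectors it is the Euclidean norm (the library norm
   on matrices is the max norm). *)
Definition l2norm {R : realType} {p q : nat} (A : 'M[R]_(p, q)) : R :=
  Num.sqrt (\sum_(i < p) \sum_(j < q) A i j ^+ 2).

(* [mxvec] is row-major, hence the transpositions: [cvec] stacks columns. *)
Definition cvec {R : realType} {p q : nat} (A : 'M[R]_(p, q)) : 'cV[R]_(q * p) :=
  (mxvec A^T)^T.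

Definition uncvec {R : realType} {p q : nat} (c : 'cV[R]_(q * p)) : 'M[R]_(p, q) :=
  (vec_mx c^T)^T.

Definition lrelu {R : realType} (alpha : R) {p q : nat} (A : 'M[R]_(p, q)) :
  'M[R]_(p, q) := map_mx (fun z => Num.max z (alpha * z)) A.

Definition global_minimizer {R : realType} {T : Type} (f : T -> R) (S : set T)
  (z : T) : Prop := S z /\ (forall z', S z' -> f z <= f z').

Definition local_minimizer {R : realType} {T : topologicalType} (f : T -> R)
  (S : set T) (z : T) : Prop := S z /\ (\forall z' \near z, S z' -> f z <= f z').

(* Layer l.+1 of the mathematical text (1 <= l.+1 <= L) corresponds to the index
   [l : 'I_L]; the width of layer l is [d l] for 0 <= l <= L, and the values of
   [d] beyond L are irrelevant. *)
Definition wdim (L : nat) (d : nat -> nat) : nat := (\sum_(l < L) d l * d l.+1)%N.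
Definition bdim (L : nat) (d : nat -> nat) : nat := (\sum_(l < L) d l.+1)%N.
(* This is N times [bdim L d], written blockwise. *)
Definition vdim (L N : nat) (d : nat -> nat) : nat := (\sum_(l < L) N * d l.+1)%N.

Definition vars (R : realType) (L N : nat) (d : nat -> nat) :=
  ('cV[R]_(wdim L d) * 'cV[R]_(bdim L d) * 'cV[R]_(vdim L N d)
   * 'cV[R]_(vdim L N d))%type.

Section Network.
Context {R : realType} {L N : nat} {d : nat -> nat}.
Implicit Types (w : 'cV[R]_(wdim L d)) (b : 'cV[R]_(bdim L d)).
Implicit Types (v u : 'cV[R]_(vdim L N d)) (beta : nat -> R).
Implicit Types (X : 'M[R]_(d 0%N, N)) (Y : 'M[R]_(d L, N)).

Definition Wmx w (l : 'I_L) : 'M[R]_(d l.+1, d l) := uncvec (submxcol w l).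

Definition bvec b (l : 'I_L) : 'cV[R]_(d l.+1) := submxcol b l.

(* V_k for 0 <= k <= L: the data X if k = 0, and otherwise the matrix whose n-th
   column is the block v_{n,k} of v. *)
Definition Vmx X v (k : 'I_L.+1) : 'M[R]_(d k, N) :=
  match k with
  | Ordinal 0 _ => X
  | Ordinal k'.+1 lt_k'L => uncvec (submxcol v (Ordinal (lt_k'L : k' < L)%N))
  end.

(* Psi(v) w: the block of index (n, l.+1) is W_{l.+1} v_{n,l}. *)
Definition Psi X v w : 'cV[R]_(vdim L N d) :=
  \mxcol_(l < L) cvec (Wmx w l *m Vmx X v (widen_ord (leqnSn L) l)).

(* A b: the block of index (n, l.+1) is b_{l.+1}, for every n. *)
Definition Amul b : 'cV[R]_(vdim L N d) :=
  \mxcol_(l < L) cvec (bvec b l *m (const_mx 1 : 'rV[R]_N)).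

Definition betavec beta : 'cV[R]_(vdim L N d) :=
  \mxcol_(l < L) const_mx (beta l.+1).

Definition R1 (lambda_w : R) w : R :=
  lambda_w * \sum_(l < L) \sum_(j < d l) l2norm (col j (Wmx w l)).

Definition R2 (lambda_v : R) v : R := lambda_v * l2norm v ^+ 2.

Definition Obar X Y (lambda_w lambda_v : R) w v : R :=
  N%:R^-1 * \sum_(n < N) l2norm (col n (Vmx X v ord_max) - col n Y) ^+ 2
  + R1 lambda_w w + R2 lambda_v v.

Definition Obeta X Y (alpha lambda_w lambda_v : R) beta w v u : R :=
  Obar X Y lambda_w lambda_v w v
  + ((betavec beta)^T *m (v - lrelu alpha u)) 0 0.

Definition Omega1 X (alpha : R) : set (vars R L N d) :=
  [set z : vars R L N d | let: (w, b, v, u) := z in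
     v = lrelu alpha u /\ u = Psi X v w + Amul b].

Definition Omega2 X (alpha : R) : set (vars R L N d) :=
  [set z : vars R L N d | let: (w, b, v, u) := z in
     [/\ forall i, 0 <= (v - u) i 0,
         forall i, 0 <= (v - alpha *: u) i 0
       & u = Psi X v w + Amul b]].

Definition objP X Y (lambda_w lambda_v : R) (z : vars R L N d) : R :=
  let: (w, b, v, u) := z in Obar X Y lambda_w lambda_v w v.

Definition objPP X Y (alpha lambda_w lambda_v : R) beta (z : vars R L N d) : R :=
  let: (w, b, v, u) := z in Obeta X Y alpha lambda_w lambda_v beta w v u.

Definition Omega_theta X Y (alpha lambda_w lambda_v : R) beta (theta : R) :
    set (vars R L N d) :=
  [set z | Omega2 X alpha z /\ objPP X Y alpha lambda_w lambda_v beta z <= theta].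

(* The least Lipschitz constant, with respect to the Euclidean norm of the pair
   (w, v), of Obar over the (w, v)-part of Omega_theta. *)
Definition LipObar X Y (alpha lambda_w lambda_v : R) beta (theta : R) : R :=
  inf [set k : R | 0 <= k /\
    forall w b v u w' b' v' u',
      Omega_theta X Y alpha lambda_w lambda_v beta theta (w, b, v, u) ->
      Omega_theta X Y alpha lambda_w lambda_v beta theta (w', b', v', u') ->
      `|Obar X Y lambda_w lambda_v w v - Obar X Y lambda_w lambda_v w' v'|
        <= k * l2norm (col_mx (w - w') (v - v'))].

End Network.

Definition theta_w {R : realType} (L : nat) (d : nat -> nat) (lambda_w theta : R) : R :=
  theta / lambda_w * Num.sqrt (bdim L d + d 0)%N%:R.

(* Main.v *)
Require Import Defs.
From HB Require Import structures.
From mathcomp Require Import all_boot all_order all_algebra.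
From mathcomp Require Import all_classical all_reals all_analysis.
From mathcomp Require Import ring lra.
Import Order.TTheory GRing.Theory Num.Theory.
Import numFieldNormedType.Exports.

Local Open Scope classical_set_scope.
Local Open Scope ring_scope.

(** The penalty is exact because violations of the network equations can always
    be repaired at a profit. For a point [(w, b, v, u)] of [Omega2] put
    [dlt = v - lrelu alpha u], the defect; it is nonnegative, and the point lies
    in [Omega1] exactly when [dlt = 0]. Keep [w] and [b] and propagate the data
    through the layers again with the smaller defect [(1 - t) dlt]: for
    [0 <= t <= 1] this gives a path [v_t] in [Omega2] from the given point
    ([t = 0]) to a point of [Omega1] ([t = 1]). Existence of [v_t] is
    [propagation_exists].

    Below level [theta] every weight matrix has norm at most
    [M = max (theta_w, 1)] ([weight_bound]). Since [lrelu] is 1-Lipschitz, a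
    change of the defect is amplified by at most [M] per layer, so [v_t] moves
    with speed at most [L M ^ L S], where [S] is the sum of the Euclidean norms of
    the layers of [dlt] ([propagation_dist]). Hence [Obar] grows along the path
    with speed at most [LipObar L M ^ L S], as long as the path stays in
    [Omega_theta], while the penalty term falls with speed
    [penalty dlt >= \sum_l beta_l |dlt_l|]. When every [beta_l] exceeds
    [LipObar L M ^ L], the penalized objective decreases, strictly if [dlt] is
    nonzero. Two points need care. [LipObar] is an infimum, and bounds anything
    only because [Obar] is Lipschitz on the bounded set [Omega_theta]
    ([Obar_lipschitz], [LipObar_lipschitz]). And the speed estimate holds inside
    [Omega_theta] only; starting strictly below [theta], a decreasing function
    cannot leave the sublevel set ([sublevel_descent]). The result is
    [repair_path].

    Following the path for a short time shows that a local minimizer of the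
    penalized problem below level [theta] has defect zero
    ([infeasible_descent]). Following it to the end turns any competitor in
    [Omega2] below level [theta] into one in [Omega1] that is no worse, at a
    distance controlled by the defect ([repair]); a competitor chosen near a
    point of [Omega1] has a small defect and is therefore repaired nearby. On
    [Omega1] the two objectives agree, and the zero point of [Omega1] has
    objective below [theta], so global minimizers lie below that level. The three
    claims follow. *)

(** * The Frobenius norm *)

Section FrobeniusNorm.
Context {R : realType}.

(** Expanding the square [(a_i b_j - a_j b_i) ^ 2] and summing over all pairs
    gives twice the difference of the two sides. *)
Lemma cauchy_schwarz_sum (I : finType) (a b : I -> R) :
  (\sum_i a i * b i) ^+ 2 <= (\sum_i a i ^+ 2) * (\sum_i b i ^+ 2).
Proof.
rewrite -subr_ge0 -(@pmulrn_lge0 _ _ 2) //.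
have -> : ((\sum_i a i ^+ 2) * (\sum_i b i ^+ 2) - (\sum_i a i * b i) ^+ 2) *+ 2
        = \sum_i \sum_j (a i * b j - a j * b i) ^+ 2.
  have E : forall x y : I -> R, (\sum_i x i) * (\sum_i y i) = \sum_i \sum_j x i * y j.
    by move=> x y; rewrite mulr_suml; apply: eq_bigr => i _; rewrite mulr_sumr.
  have E2 : (\sum_i a i ^+ 2) * (\sum_i b i ^+ 2) = \sum_i \sum_j a j ^+ 2 * b i ^+ 2.
    by rewrite E exchange_big.
  rewrite mulrnBl !mulr2n {2}E2 expr2 !E -!big_split -sumrN -big_split /=.
  apply: eq_bigr => i _; rewrite -!big_split -sumrN -big_split /=.
  by apply: eq_bigr => j _; ring.
by apply: sumr_ge0 => i _; apply: sumr_ge0 => j _; apply: sqr_ge0.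
Qed.

Lemma l2norm_ge0 {p q : nat} (A : 'M[R]_(p, q)) : 0 <= l2norm A.
Proof. exact: sqrtr_ge0. Qed.

Lemma sqr_l2norm {p q : nat} (A : 'M[R]_(p, q)) :
  l2norm A ^+ 2 = \sum_(i < p) \sum_(j < q) A i j ^+ 2.
Proof.
by rewrite sqr_sqrtr //; do 2 apply: sumr_ge0 => ? _; apply: sqr_ge0.
Qed.

Lemma sqr_l2norm_pair {p q : nat} (A : 'M[R]_(p, q)) :
  l2norm A ^+ 2 = \sum_(ij : 'I_p * 'I_q) A ij.1 ij.2 ^+ 2.
Proof. by rewrite sqr_l2norm pair_big. Qed.

Lemma le_of_sqr (x y : R) : 0 <= y -> x ^+ 2 <= y ^+ 2 -> x <= y.
Proof.
move=> y0; have [x0|/ltW x0 _] := leP 0 x; first by rewrite ler_sqr.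
exact: le_trans x0 y0.
Qed.

Lemma sum_sqr_le {I : Type} (r : seq I) (a : I -> R) :
  (forall i, 0 <= a i) -> \sum_(i <- r) a i ^+ 2 <= (\sum_(i <- r) a i) ^+ 2.
Proof.
move=> a0; elim: r => [|i r IH]; first by rewrite !big_nil expr0n.
rewrite !big_cons; set s := \sum_(_ <- r) a _ in IH *.
have s0 : 0 <= s by apply: sumr_ge0.
have : 0 <= a i * s by rewrite mulr_ge0.
by move: IH; set t := \sum_(_ <- r) _; nra.
Qed.

Lemma l2norm0 {p q : nat} : l2norm (0 : 'M[R]_(p, q)) = 0.
Proof.
apply/eqP; rewrite -sqrf_eq0 sqr_l2norm.
by apply/eqP; do 2 (apply: big1 => ? _); rewrite mxE expr0n.
Qed.

Lemma l2normZ {p q : nat} (c : R) (A : 'M[R]_(p, q)) :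
  l2norm (c *: A) = `|c| * l2norm A.
Proof.
apply/eqP; rewrite -(@eqrXn2 _ 2) ?mulr_ge0 ?l2norm_ge0 //.
rewrite exprMn !sqr_l2norm real_normK ?num_real // mulr_sumr; apply/eqP.
apply: eq_bigr => i _; rewrite mulr_sumr; apply: eq_bigr => j _.
by rewrite mxE exprMn.
Qed.

Lemma l2normN {p q : nat} (A : 'M[R]_(p, q)) : l2norm (- A) = l2norm A.
Proof. by rewrite -scaleN1r l2normZ normrN1 mul1r. Qed.

Lemma ler_l2normD {p q : nat} (A B : 'M[R]_(p, q)) :
  l2norm (A + B) <= l2norm A + l2norm B.
Proof.
apply: le_of_sqr; first by rewrite addr_ge0 ?l2norm_ge0.
have cs : \sum_(ij : 'I_p * 'I_q) A ij.1 ij.2 * B ij.1 ij.2 <= l2norm A * l2norm B.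
  apply: le_of_sqr; first by rewrite mulr_ge0 ?l2norm_ge0.
  by rewrite exprMn !sqr_l2norm_pair; apply: cauchy_schwarz_sum.
have E : l2norm (A + B) ^+ 2 = l2norm A ^+ 2 + l2norm B ^+ 2
     + 2 * \sum_(ij : 'I_p * 'I_q) A ij.1 ij.2 * B ij.1 ij.2.
  rewrite !sqr_l2norm_pair mulr_sumr -!big_split /=.
  by apply: eq_bigr => ij _; rewrite mxE; ring.
by rewrite E; move: cs; set s := \sum_(_ | _) _; nra.
Qed.

Lemma ler_l2norm_dist {p q : nat} (A B : 'M[R]_(p, q)) :
  `|l2norm A - l2norm B| <= l2norm (A - B).
Proof.
have H : forall A B : 'M[R]_(p, q), l2norm A - l2norm B <= l2norm (A - B).
  by move=> C D; rewrite lerBlDr -{1}(subrK D C) ler_l2normD.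
by rewrite ler_norml H andbT lerNl opprB -[in leRHS]l2normN opprB H.
Qed.

Lemma ler_l2normM {p q r : nat} (A : 'M[R]_(p, q)) (B : 'M[R]_(q, r)) :
  l2norm (A *m B) <= l2norm A * l2norm B.
Proof.
apply: le_of_sqr; first by rewrite mulr_ge0 ?l2norm_ge0.
rewrite exprMn !sqr_l2norm mulr_suml; apply: ler_sum => i _.
rewrite [X in _ <= _ * X]exchange_big mulr_sumr; apply: ler_sum => k _.
by rewrite mxE; apply: cauchy_schwarz_sum.
Qed.

Lemma ler_l2norm {p q p' q' : nat} (A : 'M[R]_(p, q)) (B : 'M[R]_(p', q')) :
  l2norm A ^+ 2 <= l2norm B ^+ 2 -> l2norm A <= l2norm B.
Proof. by apply: le_of_sqr; apply: l2norm_ge0. Qed.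

Lemma eq_l2norm {p q p' q' : nat} (A : 'M[R]_(p, q)) (B : 'M[R]_(p', q')) :
  l2norm A ^+ 2 = l2norm B ^+ 2 -> l2norm A = l2norm B.
Proof. by move=> E; apply/eqP; rewrite -(@eqrXn2 _ 2) ?l2norm_ge0 ?E. Qed.

Lemma sqr_l2norm_cols {p q : nat} (A : 'M[R]_(p, q)) :
  l2norm A ^+ 2 = \sum_j l2norm (col j A) ^+ 2.
Proof.
rewrite sqr_l2norm exchange_big; apply: eq_bigr => j _; rewrite sqr_l2norm.
by apply: eq_bigr => i _; rewrite big_ord1 mxE.
Qed.

Lemma l2norm_col_le {p q : nat} (A : 'M[R]_(p, q)) j : l2norm (col j A) <= l2norm A.
Proof.
apply: ler_l2norm; rewrite [leRHS]sqr_l2norm_cols (bigD1 j) //= lerDl.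
by apply: sumr_ge0 => *; apply: sqr_ge0.
Qed.

Lemma l2norm_le_sum_cols {p q : nat} (A : 'M[R]_(p, q)) :
  l2norm A <= \sum_j l2norm (col j A).
Proof.
apply: le_of_sqr; first by apply: sumr_ge0 => *; apply: l2norm_ge0.
by rewrite sqr_l2norm_cols; apply: sum_sqr_le => j; apply: l2norm_ge0.
Qed.

Lemma l2norm_le_sum_entries {n : nat} (x : 'cV[R]_n) :
  l2norm x <= \sum_i `|x i 0|.
Proof.
apply: le_of_sqr; first by apply: sumr_ge0.
rewrite sqr_l2norm; apply: le_trans (sum_sqr_le _ _ _) => //.
by apply: ler_sum => i _; rewrite big_ord1 real_normK ?num_real.
Qed.

Lemma mx_norm_le_l2norm {p q : nat} (A : 'M[R]_(p, q)) : `|A| <= l2norm A.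
Proof.
rewrite [leLHS]/Num.Def.normr/= mx_normrE.
apply: bigmax_le => [|ij _]; first exact: l2norm_ge0.
apply: le_of_sqr; first exact: l2norm_ge0.
rewrite real_normK ?num_real // sqr_l2norm_pair (bigD1 ij) //= lerDl.
by apply: sumr_ge0 => *; apply: sqr_ge0.
Qed.

Lemma entry_le_mx_norm {p q : nat} (A : 'M[R]_(p, q)) i j : `|A i j| <= `|A|.
Proof.
rewrite [leRHS]/Num.Def.normr/= mx_normrE; apply/bigmax_geP; right.
by exists (i, j).
Qed.

Lemma l2norm_le_mx_norm {n : nat} (x : 'cV[R]_n) : l2norm x <= n%:R * `|x|.
Proof.
apply: le_trans (l2norm_le_sum_entries x) _.
apply: le_trans (ler_sum _ (fun i _ => entry_le_mx_norm x i 0)) _.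
by rewrite sumr_const card_ord mulr_natl.
Qed.

Lemma lrelu_scalar_dist (alpha x y : R) : 0 < alpha -> alpha < 1 ->
  `|Num.max x (alpha * x) - Num.max y (alpha * y)| <= `|x - y|.
Proof.
move=> a0 a1.
wlog le_xy : x y / x <= y.
  by move=> H; have [/H//|/ltW/H] := leP x y; rewrite distrC (distrC y).
have le_max : Num.max x (alpha * x) <= Num.max y (alpha * y).
  rewrite ge_max !le_max le_xy /=; apply/orP; right; nra.
rewrite distrC (distrC x) !ger0_norm ?subr_ge0 //.
by case: (leP x (alpha * x)); case: (leP y (alpha * y)); nra.
Qed.

Lemma l2norm_lrelu_dist (alpha : R) {p q : nat} (A B : 'M[R]_(p, q)) :
  0 < alpha -> alpha < 1 ->
  l2norm (lrelu alpha A - lrelu alpha B) <= l2norm (A - B).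
Proof.
move=> a0 a1; apply: ler_l2norm; rewrite !sqr_l2norm.
apply: ler_sum => i _; apply: ler_sum => j _; rewrite !mxE.
rewrite -[leLHS]real_normK ?num_real // -[leRHS]real_normK ?num_real //.
by rewrite ler_sqr ?nnegrE // lrelu_scalar_dist.
Qed.

Lemma sum_mxvec_index {p q : nat} (F : 'I_(p * q) -> R) :
  \sum_k F k = \sum_i \sum_j F (mxvec_index i j).
Proof.
rewrite pair_big /= (reindex _ (curry_mxvec_bij _ _)) /=.
by apply: eq_bigr => -[i j].
Qed.

Lemma uncvecK {p q : nat} (c : 'cV[R]_(q * p)) : cvec (uncvec c) = c.
Proof. by rewrite /uncvec /cvec trmxK vec_mxK trmxK. Qed.

Lemma l2norm_cvec {p q : nat} (A : 'M[R]_(p, q)) : l2norm (cvec A) = l2norm A.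
Proof.
apply: eq_l2norm; rewrite !sqr_l2norm sum_mxvec_index exchange_big /=.
by do 2 apply: eq_bigr => ? _; rewrite big_ord1 /cvec mxE mxvecE mxE.
Qed.

Lemma l2norm_uncvec {p q : nat} (c : 'cV[R]_(q * p)) :
  l2norm (uncvec c : 'M[R]_(p, q)) = l2norm c.
Proof. by rewrite -[in RHS](uncvecK c) l2norm_cvec. Qed.

Lemma uncvecB {p q : nat} (c c' : 'cV[R]_(q * p)) :
  uncvec (c - c') = uncvec c - uncvec c' :> 'M[R]_(p, q).
Proof. by rewrite /uncvec !linearB. Qed.

Lemma cvecB {p q : nat} (A B : 'M[R]_(p, q)) : cvec (A - B) = cvec A - cvec B.
Proof. by rewrite /cvec !linearB. Qed.

Lemma l2norm_col_mx {p q : nat} (a : 'cV[R]_p) (b : 'cV[R]_q) :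
  l2norm (col_mx a b) ^+ 2 = l2norm a ^+ 2 + l2norm b ^+ 2.
Proof.
rewrite !sqr_l2norm big_split_ord /=; congr (_ + _); apply: eq_bigr => i _.
  by rewrite !big_ord1 col_mxEu.
by rewrite !big_ord1 col_mxEd.
Qed.

(** * Block column vectors *)

Lemma sqr_l2norm_blocks {m : nat} {p_ : 'I_m -> nat}
    (x : 'cV[R]_(\sum_(l < m) p_ l)) :
  l2norm x ^+ 2 = \sum_l l2norm (submxcol x l) ^+ 2.
Proof.
have E : forall n (y : 'cV[R]_n), l2norm y ^+ 2 = (y^T *m y) 0 0.
  move=> n y; rewrite sqr_l2norm mxE; apply: eq_bigr => i _.
  by rewrite big_ord1 mxE expr2.
rewrite E -{1 2}(submxcolK x) tr_mxcol mul_mxrow_mxcol summxE.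
by apply: eq_bigr => l _; rewrite -E.
Qed.

Definition blocknorm {m : nat} {p_ : 'I_m -> nat}
    (x : 'cV[R]_(\sum_(l < m) p_ l)) : R := \sum_l l2norm (submxcol x l).

Section Blocks.
Context {m : nat} {p_ : 'I_m -> nat}.
Implicit Type x : 'cV[R]_(\sum_(l < m) p_ l).

Lemma l2norm_block_le x l : l2norm (submxcol x l) <= l2norm x.
Proof.
apply: ler_l2norm; rewrite [leRHS]sqr_l2norm_blocks (bigD1 l) //= lerDl.
by apply: sumr_ge0 => *; apply: sqr_ge0.
Qed.

Lemma blocknorm_ge0 x : 0 <= blocknorm x.
Proof. by apply: sumr_ge0 => *; apply: l2norm_ge0. Qed.

Lemma l2norm_le_blocknorm x : l2norm x <= blocknorm x.
Proof.
apply: le_of_sqr; first exact: blocknorm_ge0.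
by rewrite sqr_l2norm_blocks; apply: sum_sqr_le => l; apply: l2norm_ge0.
Qed.

Lemma blocknorm_le_l2norm x : blocknorm x <= m%:R * l2norm x.
Proof.
apply: le_trans (ler_sum _ (fun l _ => l2norm_block_le x l)) _.
by rewrite sumr_const card_ord mulr_natl.
Qed.

Lemma blocknormZ c x : blocknorm (c *: x) = `|c| * blocknorm x.
Proof.
rewrite /blocknorm mulr_sumr; apply: eq_bigr => l _.
rewrite -l2normZ; congr l2norm; apply/matrixP => i j; by rewrite !mxE.
Qed.

End Blocks.

End FrobeniusNorm.

(** * Forward propagation with perturbed activations *)

Section Propagation.
Context {R : realType} {L N : nat} {d : nat -> nat}.
Context (X : 'M[R]_(d 0%N, N)) (alpha : R).
Implicit Types (w : 'cV[R]_(wdim L d)) (b : 'cV[R]_(bdim L d)).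
Implicit Types (v u dlt : 'cV[R]_(vdim L N d)).

Lemma Vmx0 v (h : (0 < L.+1)%N) : Vmx X v (Ordinal h) = X.
Proof. by []. Qed.

Lemma VmxS v (k : nat) (h : (k.+1 < L.+1)%N) :
  Vmx X v (Ordinal h) = uncvec (submxcol v (Ordinal (h : (k < L)%N))).
Proof. by []. Qed.

Lemma Vmx_congr v v' (k : 'I_L.+1) :
  (forall l : 'I_L, l.+1 = k -> submxcol v l = submxcol v' l) ->
  Vmx X v k = Vmx X v' k.
Proof. by case: k => -[|k] hk E; rewrite ?Vmx0 // !VmxS E. Qed.

Lemma Vmx_dist_le v v' k : l2norm (Vmx X v k - Vmx X v' k) <= l2norm (v - v').
Proof.
case: k => -[|k] hk /=; first by rewrite subrr l2norm0 l2norm_ge0.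
by rewrite -uncvecB -submxcolB l2norm_uncvec l2norm_block_le.
Qed.

Lemma Vmx_norm_le v k : l2norm (Vmx X v k) <= l2norm X + l2norm v.
Proof.
case: k => -[|k] hk /=; first by rewrite lerDl l2norm_ge0.
by rewrite l2norm_uncvec; apply: le_trans (l2norm_block_le _ _) _;
   rewrite lerDr l2norm_ge0.
Qed.

Lemma Vmx_inj v v' : (forall k, Vmx X v k = Vmx X v' k) -> v = v'.
Proof.
move=> E; apply/mxcolP => -[l hl].
by have /= := E (Ordinal (hl : (l.+1 < L.+1)%N)) => /(congr1 cvec); rewrite !uncvecK.
Qed.

Lemma submxcol_lrelu v l : submxcol (lrelu alpha v) l = lrelu alpha (submxcol v l).
Proof. by apply/matrixP => i j; rewrite !mxE. Qed.

Lemma submxcol_Psi v w l : submxcol (Psi X v w) l =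
  cvec (Wmx w l *m Vmx X v (widen_ord (leqnSn L) l)).
Proof. by rewrite mxcolK. Qed.

Lemma Psi_block_dist v v' w l :
  l2norm (submxcol (Psi X v w - Psi X v' w) l) <=
  l2norm (Wmx w l) * l2norm (Vmx X v (widen_ord (leqnSn L) l)
                             - Vmx X v' (widen_ord (leqnSn L) l)).
Proof.
by rewrite submxcolB !submxcol_Psi -cvecB l2norm_cvec -mulmxBr ler_l2normM.
Qed.

(** For every feasible point of either problem, [v] is a fixed point of [step]
    when [dlt] is the defect [v - lrelu alpha u]. *)
Definition step w b dlt v := lrelu alpha (Psi X v w + Amul b) + dlt.

Lemma submxcol_step w b dlt v l : submxcol (step w b dlt v) l =
  lrelu alpha (cvec (Wmx w l *m Vmx X v (widen_ord (leqnSn L) l))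
               + submxcol (Amul b) l) + submxcol dlt l.
Proof. by rewrite /step submxcolD submxcol_lrelu submxcolD submxcol_Psi. Qed.

Lemma step_local w b dlt v v' (n : nat) :
  (forall k : 'I_L.+1, (k <= n)%N -> Vmx X v k = Vmx X v' k) ->
  forall k : 'I_L.+1, (k <= n.+1)%N ->
    Vmx X (step w b dlt v) k = Vmx X (step w b dlt v') k.
Proof.
move=> E k le_kn; apply: Vmx_congr => l kE.
have le_ln : (widen_ord (leqnSn L) l <= n)%N by rewrite /= -ltnS kE.
by rewrite (submxcol_step w b dlt v l) (submxcol_step w b dlt v' l) (E _ le_ln).
Qed.

(** Layer [l] of [step] depends on the layers before [l] only, so after [L]
    iterations every layer has become stationary. *)
Lemma propagation_exists w b dlt : exists v, v = step w b dlt v.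
Proof.
pose F := step w b dlt.
have E : forall n (k : 'I_L.+1), (k <= n)%N ->
    Vmx X (iter n F 0) k = Vmx X (F (iter n F 0)) k.
  elim=> [|n IH] k le_kn; last by rewrite iterS; exact: (step_local w b dlt _ _ n IH).
  by case: k le_kn => -[|k] // h _; rewrite !Vmx0.
exists (iter L F 0); apply: Vmx_inj => k; apply: E.
by rewrite -ltnS ltn_ord.
Qed.

Hypotheses (alpha_gt0 : 0 < alpha) (alpha_lt1 : alpha < 1).

Section Stability.
Context (w : 'cV[R]_(wdim L d)) (b : 'cV[R]_(bdim L d)) (M : R).
Hypotheses (M_ge1 : 1 <= M) (W_le : forall l, l2norm (Wmx w l) <= M).
Context (v v' dlt dlt' : 'cV[R]_(vdim L N d)).
Hypotheses (vE : v = step w b dlt v) (v'E : v' = step w b dlt' v').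

(** Since [lrelu] is 1-Lipschitz, a defect in layer [j] is amplified by at most
    [M] in each later layer. *)
Lemma propagation_layer_dist k (hk : (k < L.+1)%N) :
  l2norm (Vmx X v (Ordinal hk) - Vmx X v' (Ordinal hk)) <=
  M ^+ k * \sum_(j < L | (j < k)%N) l2norm (submxcol (dlt - dlt') j).
Proof.
elim: k hk => [|k IH] hk.
  by rewrite /= subrr l2norm0 mulr_ge0 ?exprn_ge0 ?sumr_ge0 ?(le_trans ler01) // => *; exact: l2norm_ge0.
have hk' : (k < L)%N := hk; pose l : 'I_L := Ordinal hk'.
have M0 : 0 <= M := le_trans ler01 M_ge1.
have -> : Vmx X v (Ordinal hk) - Vmx X v' (Ordinal hk) = uncvec (submxcol (v - v') l).
  rewrite /= submxcolB uncvecB.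
  by rewrite /l (bool_irrelevance hk' hk).
rewrite l2norm_uncvec {1}vE {1}v'E.
rewrite /step opprD addrACA submxcolD.
apply: le_trans (ler_l2normD _ _) _.
rewrite (bigD1 l) //= mulrDr [leLHS]addrC lerD //.
  by rewrite ler_peMl ?l2norm_ge0 // exprn_ege1.
rewrite submxcolB !submxcol_lrelu.
apply: le_trans (l2norm_lrelu_dist _ _ _ alpha_gt0 alpha_lt1) _.
rewrite -submxcolB opprD addrACA subrr addr0.
apply: (le_trans (Psi_block_dist v v' w l)).
rewrite exprS -mulrA ler_pM ?l2norm_ge0 //.
apply: le_trans (IH _) _; rewrite ler_wpM2l ?exprn_ge0 //.
rewrite le_eqVlt; apply/orP; left; apply/eqP; apply: eq_bigl => j.
by rewrite -(inj_eq val_inj) /= ltnS andbC -ltn_neqAle.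
Qed.

Lemma propagation_layer_dist_le k :
  l2norm (Vmx X v k - Vmx X v' k) <= M ^+ L * blocknorm (dlt - dlt').
Proof.
case: k => k hk; apply: le_trans (propagation_layer_dist _ _) _.
have M0 : 0 <= M := le_trans ler01 M_ge1.
rewrite ler_pM ?exprn_ge0 //.
- by apply: sumr_ge0 => *; exact: l2norm_ge0.
- by rewrite ler_weXn2l // -ltnS.
rewrite /blocknorm big_mkcond; apply: ler_sum => j _.
by case: ifP => // _; exact: l2norm_ge0.
Qed.

Lemma propagation_dist :
  l2norm (v - v') <= L%:R * M ^+ L * blocknorm (dlt - dlt').
Proof.
apply: le_trans (l2norm_le_blocknorm _) _.
have H (l : 'I_L) : l2norm (submxcol (v - v') l) <= M ^+ L * blocknorm (dlt - dlt').
  case: l => l hl; have := propagation_layer_dist_le (Ordinal (hl : (l.+1 < L.+1)%N)).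
  by rewrite /= -uncvecB -submxcolB l2norm_uncvec.
apply: le_trans (ler_sum _ (fun l _ => H l)) _.
by rewrite sumr_const card_ord -mulrA mulr_natl.
Qed.

Lemma preactivation_dist :
  l2norm (Psi X v w - Psi X v' w) <= L%:R * M ^+ L.+1 * blocknorm (dlt - dlt').
Proof.
apply: le_trans (l2norm_le_blocknorm _) _.
have M0 : 0 <= M := le_trans ler01 M_ge1.
have H (l : 'I_L) : l2norm (submxcol (Psi X v w - Psi X v' w) l)
    <= M ^+ L.+1 * blocknorm (dlt - dlt').
  apply: (le_trans (Psi_block_dist v v' w l)).
  by rewrite exprS -mulrA ler_pM ?l2norm_ge0 ?propagation_layer_dist_le.
apply: le_trans (ler_sum _ (fun l _ => H l)) _.
by rewrite sumr_const card_ord -mulrA mulr_natl.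
Qed.

End Stability.
End Propagation.

(** * Lipschitz continuity of the objective on bounded sets *)

Section Objective.
Context {R : realType} {L N : nat} {d : nat -> nat}.
Context (X : 'M[R]_(d 0%N, N)) (Y : 'M[R]_(d L, N)).
Implicit Types (w : 'cV[R]_(wdim L d)) (b : 'cV[R]_(bdim L d)).
Implicit Types (v u dlt : 'cV[R]_(vdim L N d)).

Lemma sqr_l2norm_dist {p q : nat} (C : R) (A B : 'M[R]_(p, q)) :
  l2norm A <= C -> l2norm B <= C ->
  `|l2norm A ^+ 2 - l2norm B ^+ 2| <= 2 * C * l2norm (A - B).
Proof.
move=> AC BC; rewrite subr_sqr normrM mulrC.
apply: ler_pM => //; last exact: ler_l2norm_dist.
rewrite ger0_norm ?addr_ge0 ?l2norm_ge0 //; lra.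
Qed.

Lemma WmxB w w' l : Wmx (w - w') l = Wmx w l - Wmx w' l.
Proof. by rewrite /Wmx submxcolB uncvecB. Qed.

Lemma R1_dist (lambda_w : R) w w' : 0 <= lambda_w ->
  `|R1 lambda_w w - R1 lambda_w w'| <=
  lambda_w * (\sum_(l < L) \sum_(j < d l) 1) * l2norm (w - w').
Proof.
move=> lw0; rewrite /R1 -mulrBr normrM ger0_norm // -mulrA ler_wpM2l //.
rewrite -sumrB mulr_suml; apply: le_trans (ler_norm_sum _ _ _) _.
apply: ler_sum => l _; rewrite -sumrB mulr_suml.
apply: le_trans (ler_norm_sum _ _ _) _.
apply: ler_sum => j _; rewrite mul1r.
apply: le_trans (ler_l2norm_dist _ _) _.
have -> : col j (Wmx w l) - col j (Wmx w' l) = col j (Wmx (w - w') l).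
  by rewrite WmxB; apply/matrixP => i k; rewrite !mxE.
apply: le_trans (l2norm_col_le _ _) _.
by rewrite l2norm_uncvec l2norm_block_le.
Qed.

Lemma sum_sqr_col_dist (V : 'M[R]_(d L, N)) :
  \sum_(n < N) l2norm (col n V - col n Y) ^+ 2 = l2norm (V - Y) ^+ 2.
Proof.
rewrite sqr_l2norm_cols; apply: eq_bigr => n _; congr (l2norm _ ^+ 2).
by apply/matrixP => i k; rewrite !mxE.
Qed.

Lemma Obar_lipschitz (lambda_w lambda_v B : R) :
  0 <= lambda_w -> 0 <= lambda_v -> 0 <= B ->
  exists2 K, 0 <= K & forall w v w' v',
    l2norm v <= B -> l2norm v' <= B ->
    `|Obar X Y lambda_w lambda_v w v - Obar X Y lambda_w lambda_v w' v'|
    <= K * l2norm (col_mx (w - w') (v - v')).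
Proof.
move=> lw0 lv0 B0.
pose C := l2norm X + B + l2norm Y.
pose Kd := N%:R^-1 * (2 * C); pose K1 := lambda_w * (\sum_(l < L) \sum_(j < d l) 1).
pose K2 := lambda_v * (2 * B).
have Kd0 : 0 <= Kd by rewrite !mulr_ge0 ?invr_ge0 ?ler0n ?addr_ge0 ?l2norm_ge0.
have K10 : 0 <= K1.
  by rewrite mulr_ge0 //; apply: sumr_ge0 => *; apply: sumr_ge0.
have K20 : 0 <= K2 by rewrite !mulr_ge0.
exists (Kd + K1 + K2) => [|w v w' v' vB v'B]; first by rewrite !addr_ge0.
have le_w : l2norm (w - w') <= l2norm (col_mx (w - w') (v - v')).
  by apply: ler_l2norm; rewrite l2norm_col_mx lerDl sqr_ge0.
have le_v : l2norm (v - v') <= l2norm (col_mx (w - w') (v - v')).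
  by apply: ler_l2norm; rewrite l2norm_col_mx lerDr sqr_ge0.
set D := l2norm (col_mx _ _) in le_w le_v *.
rewrite /Obar !sum_sqr_col_dist.
set s := l2norm _; set s' := l2norm _.
have dat : `|N%:R^-1 * s ^+ 2 - N%:R^-1 * s' ^+ 2| <= Kd * D.
  rewrite -mulrBr normrM ger0_norm ?invr_ge0 ?ler0n // -!mulrA.
  rewrite ler_wpM2l ?invr_ge0 ?ler0n // mulrA.
  apply: le_trans (sqr_l2norm_dist C _ _ _ _) _; last first.
  - rewrite ler_wpM2l ?mulr_ge0 ?addr_ge0 ?l2norm_ge0 //.
    rewrite opprB addrA subrK; apply: le_trans le_v.
    exact: (Vmx_dist_le X v v' ord_max).
  - apply: le_trans (ler_l2normD _ _) _; rewrite l2normN lerD2r.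
    by apply: (le_trans (Vmx_norm_le X v' ord_max)); rewrite lerD2l.
  - apply: le_trans (ler_l2normD _ _) _; rewrite l2normN lerD2r.
    by apply: (le_trans (Vmx_norm_le X v ord_max)); rewrite lerD2l.
have r1 : `|R1 lambda_w w - R1 lambda_w w'| <= K1 * D.
  by apply: (le_trans (R1_dist lambda_w w w' lw0)); rewrite ler_wpM2l.
have r2 : `|R2 lambda_v v - R2 lambda_v v'| <= K2 * D.
  rewrite /R2 -mulrBr normrM ger0_norm // /K2 -!mulrA ler_wpM2l // mulrA.
  apply: le_trans (sqr_l2norm_dist _ _ _ vB v'B) _.
  by rewrite ler_wpM2l ?mulr_ge0.
set a := N%:R^-1 * _ in dat *; set a' := N%:R^-1 * _ in dat *.
set r := R1 _ w in r1 *; set r' := R1 _ w' in r1 *.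
set t := R2 _ v in r2 *; set t' := R2 _ v' in r2 *.
have -> : a + r + t - (a' + r' + t') = (a - a') + (r - r') + (t - t') by ring.
rewrite !mulrDl; apply: le_trans (ler_normD _ _) _; apply: lerD => //.
by apply: le_trans (ler_normD _ _) _; apply: lerD.
Qed.

End Objective.

(** * Descent along a path inside a sublevel set *)

(** A decrease that is available only below [theta] propagates along the whole
    interval: in steps so short that [f] cannot climb from [f 0] to [theta]
    within one of them, the sublevel set is never left. *)
Lemma sublevel_descent {R : realType} (f : R -> R) (K c theta : R) :
  0 <= c -> f 0 < theta ->
  (forall s t, 0 <= s -> s <= t -> t <= 1 -> f t <= f s + K * (t - s)) ->
  (forall s t, 0 <= s -> s <= t -> t <= 1 -> f s <= theta -> f t <= theta ->
     f t <= f s - (t - s) * c) ->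
  forall t, 0 <= t -> t <= 1 -> f t <= f 0 - t * c.
Proof.
move=> c0 f0 lip desc t t0 t1.
pose n := (Num.bound (`|K| / (theta - f 0))).+1.
have gap0 : 0 < theta - f 0 by rewrite subr_gt0.
have n0 : (0 : R) < n%:R by rewrite ltr0n.
(* In one step of length at most [1 / n], [f] rises by at most the room left. *)
have short : K / n%:R <= theta - f 0.
  rewrite ler_pdivrMr // mulrC -ler_pdivrMr // (le_trans (y := `|K| / (theta - f 0))) //.
    by rewrite ler_pM2r ?invr_gt0 // ler_norm.
  apply: le_trans (ltW (archi_boundP _)) _; first by rewrite divr_ge0 // ltW.
  by rewrite ler_nat leqnSn.
have H i : (i <= n)%N -> f (i%:R * (t / n%:R)) <= f 0 - i%:R * (t / n%:R) * c.
  elim: i => [_|i IH lt_in]; first by rewrite !mul0r subr0.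
  have {}IH := IH (ltnW lt_in).
  set h := t / n%:R in IH *.
  have h0 : 0 <= h by rewrite divr_ge0 // ltW.
  set s := i%:R * h in IH *.
  have s0 : 0 <= s by rewrite mulr_ge0.
  have E : i.+1%:R * h = s + h by rewrite -natr1 mulrDl mul1r.
  have le1 : s + h <= 1.
    rewrite -E /h mulrA ler_pdivrMr // mul1r (le_trans (y := n%:R * 1)) ?mulr1 //.
    by rewrite -[leRHS]mulr1 ler_pM // ler_nat.
  have sc0 : 0 <= s * c by rewrite mulr_ge0.
  have Kh : K * h <= theta - f 0.
    rewrite /h mulrCA; case: (leP 0 (K / n%:R)) => [K0|/ltW K0].
      by apply: le_trans short; rewrite ler_piMl.
    by apply: le_trans (ltW gap0); rewrite mulr_ge0_le0.
  have subh : s + h - s = h by ring.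
  have lipS := lip s (s + h) s0 _ le1.
  have descS := desc s (s + h) s0 _ le1.
  rewrite E; move: lipS descS; rewrite lerDl h0 subh => /(_ isT) lipS /(_ isT) descS.
  have fs : f s <= theta by lra.
  have fsh : f (s + h) <= theta by lra.
  by move: (descS fs fsh); lra.
have := H n (leqnn n).
by rewrite mulrCA mulfV ?gt_eqF // mulr1.
Qed.

(** * Repairing the network equations *)

Section Repair.
Context {R : realType} {L N : nat} {d : nat -> nat}.
Context (X : 'M[R]_(d 0%N, N)) (Y : 'M[R]_(d L, N)).
Context (alpha lambda_w lambda_v : R) (beta : nat -> R) (theta : R).
Hypotheses (d0_gt0 : (0 < d 0)%N).
Hypotheses (alpha_gt0 : 0 < alpha) (alpha_lt1 : alpha < 1).
Hypotheses (lambda_w_gt0 : 0 < lambda_w) (lambda_v_gt0 : 0 < lambda_v).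
Hypothesis beta_gt0 : forall l : nat, (1 <= l <= L)%N -> 0 < beta l.
Hypothesis theta_gt0 : 0 < theta.
Implicit Types (w : 'cV[R]_(wdim L d)) (b : 'cV[R]_(bdim L d)).
Implicit Types (v u dlt : 'cV[R]_(vdim L N d)).

Let Ob := Obar X Y lambda_w lambda_v.
Let O := Obeta X Y alpha lambda_w lambda_v beta.
Let Lip := LipObar X Y alpha lambda_w lambda_v beta theta.
Let M := Num.max (theta_w L d lambda_w theta) 1.

Definition penalty dlt : R := ((betavec beta)^T *m dlt) 0 0.

Lemma penaltyE dlt :
  penalty dlt = \sum_(l < L) beta l.+1 * \sum_i submxcol dlt l i 0.
Proof.
rewrite /penalty /betavec -{1}(submxcolK dlt) tr_mxcol mul_mxrow_mxcol summxE.
apply: eq_bigr => l _; rewrite mxE mulr_sumr.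
by apply: eq_bigr => i _; rewrite !mxE.
Qed.

Lemma penaltyZ c dlt : penalty (c *: dlt) = c * penalty dlt.
Proof. by rewrite /penalty -scalemxAr mxE. Qed.

Lemma penalty_ge_blocks dlt : (forall i, 0 <= dlt i 0) ->
  \sum_(l < L) beta l.+1 * l2norm (submxcol dlt l) <= penalty dlt.
Proof.
move=> dlt0; rewrite penaltyE; apply: ler_sum => l _.
rewrite ler_wpM2l //; first by rewrite ltW // beta_gt0 ?ltn_ord.
apply: le_trans (l2norm_le_sum_entries _) _; apply: ler_sum => i _.
by rewrite ger0_norm // mxE.
Qed.

Lemma penalty_ge0 dlt : (forall i, 0 <= dlt i 0) -> 0 <= penalty dlt.
Proof.
move=> dlt0; apply: le_trans _ (penalty_ge_blocks dlt dlt0).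
by apply: sumr_ge0 => l _; rewrite mulr_ge0 ?l2norm_ge0 // ltW // beta_gt0 ?ltn_ord.
Qed.

Lemma OE w v u : O w v u = Ob w v + penalty (v - lrelu alpha u).
Proof. by []. Qed.

Lemma Omega2P w b v u : Omega2 X alpha (w, b, v, u) <->
  u = Psi X v w + Amul b /\ forall i, 0 <= (v - lrelu alpha u) i 0.
Proof.
split=> [[H1 H2 E]|[E H]].
  split=> // i; move: (H1 i) (H2 i); rewrite !mxE !subr_ge0 => h1 h2.
  by rewrite ge_max h1.
by split=> // i; move: (H i); rewrite !mxE !subr_ge0 ge_max => /andP[].
Qed.

Lemma Omega1P w b v u : Omega1 X alpha (w, b, v, u) <->
  Omega2 X alpha (w, b, v, u) /\ v - lrelu alpha u = 0.
Proof.
split=> [[E1 E2]|[/Omega2P[E _] /subr0_eq E1]]; last by split.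
have E0 : v - lrelu alpha u = 0 by rewrite {1}E1 subrr.
by split=> //; apply/Omega2P; split=> // i; rewrite E0 mxE.
Qed.

Lemma objPP_Omega1 z : Omega1 X alpha z ->
  objPP X Y alpha lambda_w lambda_v beta z = objP X Y lambda_w lambda_v z.
Proof.
move: z => [[[w b] v] u] /Omega1P[_ E].
by rewrite /= -/O OE E /penalty mulmx0 mxE addr0.
Qed.

Lemma data_ge0 v :
  0 <= N%:R^-1 * \sum_(n < N) l2norm (col n (Vmx X v ord_max) - col n Y) ^+ 2.
Proof.
by rewrite mulr_ge0 ?invr_ge0 //; apply: sumr_ge0 => *; exact: sqr_ge0.
Qed.

Lemma R1_ge0 w : 0 <= R1 lambda_w w.
Proof.
rewrite mulr_ge0 ?(ltW lambda_w_gt0) //.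
by do 2 apply: sumr_ge0 => *; exact: l2norm_ge0.
Qed.

Lemma R2_ge0 v : 0 <= R2 lambda_v v.
Proof. by rewrite mulr_ge0 ?(ltW lambda_v_gt0) // sqr_ge0. Qed.

(** The group-lasso term [R1] alone bounds the norm of a single matrix by
    [theta / lambda_w]; the square root in [theta_w] is at least 1. *)
Lemma weight_bound w v (l : 'I_L) : Ob w v <= theta -> l2norm (Wmx w l) <= M.
Proof.
move=> Ob_le; rewrite /M le_max; apply/orP; left.
have R1_le : R1 lambda_w w <= theta.
  by move: (data_ge0 v) (R2_ge0 v) Ob_le; rewrite /Ob /Obar; lra.
have le_q : l2norm (Wmx w l) <= theta / lambda_w.
  rewrite ler_pdivlMr // mulrC; apply: le_trans R1_le.
  rewrite /R1 ler_pM2l // (bigD1 l) //=.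
  apply: le_trans (l2norm_le_sum_cols _) _; rewrite lerDl.
  by do 2 apply: sumr_ge0 => *; exact: l2norm_ge0.
have q0 : 0 <= theta / lambda_w by apply: divr_ge0; apply: ltW.
apply: le_trans le_q _; rewrite /theta_w ler_peMr //.
rewrite -[leLHS]sqrtr1 ler_sqrt // ler1n addn_gt0 d0_gt0 orbT //.
Qed.

Lemma activation_bound w v : Ob w v <= theta ->
  l2norm v <= Num.sqrt (theta / lambda_v).
Proof.
move=> Ob_le; apply: le_of_sqr; first exact: sqrtr_ge0.
have q0 : 0 <= theta / lambda_v by apply: divr_ge0; apply: ltW.
rewrite (sqr_sqrtr q0) ler_pdivlMr // mulrC.
by move: (data_ge0 v) (R1_ge0 w) Ob_le; rewrite /Ob /Obar /R2; lra.
Qed.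

Lemma Ob_le_O w b v u : Omega2 X alpha (w, b, v, u) -> Ob w v <= O w v u.
Proof. by move=> /Omega2P[_ H]; rewrite OE lerDl penalty_ge0. Qed.

(** Otherwise [LipObar], the infimum of an empty set, would be 0 and carry no
    information. *)
Lemma LipObar_set_nonempty : exists k : R, 0 <= k /\
    forall w b v u w' b' v' u',
      Omega_theta X Y alpha lambda_w lambda_v beta theta (w, b, v, u) ->
      Omega_theta X Y alpha lambda_w lambda_v beta theta (w', b', v', u') ->
      `|Ob w v - Ob w' v'| <= k * l2norm (col_mx (w - w') (v - v')).
Proof.
have [K K0 H] := Obar_lipschitz X Y lambda_w lambda_v (Num.sqrt (theta / lambda_v))
  (ltW lambda_w_gt0) (ltW lambda_v_gt0) (sqrtr_ge0 _).
exists K; split=> // w b v u w' b' v' u' [feas le_th] [feas' le_th'].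
apply: H; apply: activation_bound.
  exact: le_trans (Ob_le_O _ _ _ _ feas) le_th.
exact: le_trans (Ob_le_O _ _ _ _ feas') le_th'.
Qed.

Lemma LipObar_ge0 : 0 <= Lip.
Proof.
by apply: lb_le_inf; [exact: LipObar_set_nonempty | move=> k []].
Qed.

(** The infimum defining [LipObar] is itself a Lipschitz constant: each of the
    inequalities it ranges over is closed in the constant. *)
Lemma LipObar_lipschitz w b v u w' b' v' u' :
  Omega_theta X Y alpha lambda_w lambda_v beta theta (w, b, v, u) ->
  Omega_theta X Y alpha lambda_w lambda_v beta theta (w', b', v', u') ->
  `|Ob w v - Ob w' v'| <= Lip * l2norm (col_mx (w - w') (v - v')).
Proof.
move=> th th'; have [k0 [k00 H0]] := LipObar_set_nonempty.
set D := l2norm _; have := l2norm_ge0 (col_mx (w - w') (v - v')).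
rewrite -/D le_eqVlt => /orP[/eqP D0|D0].
  by have := H0 _ _ _ _ _ _ _ _ th th'; rewrite -/D -D0 !mulr0.
rewrite -ler_pdivrMr //; apply: lb_le_inf; first exact: LipObar_set_nonempty.
by move=> k [_ Hk]; rewrite ler_pdivrMr //; exact: Hk th th'.
Qed.

Lemma M_ge1 : 1 <= M.
Proof. by rewrite /M le_max lexx orbT. Qed.

(** A lower bound for the speed at which the penalized objective decreases while
    the defect is shrunk: loss of penalty minus largest possible gain of [Obar]. *)
Definition repair_rate dlt : R :=
  penalty dlt - Lip * (L%:R * M ^+ L * blocknorm dlt).

(** Shrinking the defect by the factor [1 - t] moves the activations by a
    multiple of [t] and removes the fraction [t] of the penalty; [repair_rate]
    is what this gains per unit of [t]. *)
Lemma repair_path w b v u :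
  Omega2 X alpha (w, b, v, u) -> O w v u < theta ->
  0 <= repair_rate (v - lrelu alpha u) ->
  forall t, 0 <= t -> t <= 1 ->
  exists v' u',
    [/\ Omega2 X alpha (w, b, v', u'),
        v' - lrelu alpha u' = (1 - t) *: (v - lrelu alpha u),
        O w v' u' <= O w v u - t * repair_rate (v - lrelu alpha u),
        l2norm (v - v') <= t * (L%:R * M ^+ L.+1 * blocknorm (v - lrelu alpha u))
      & l2norm (u - u') <= t * (L%:R * M ^+ L.+1 * blocknorm (v - lrelu alpha u))].
Proof.
move=> feas; have [uE dlt0] := proj1 (Omega2P _ _ _ _) feas.
set dlt := v - lrelu alpha u in dlt0 *; move=> Olt rate0.
have [vt vtE] := choice (fun t => propagation_exists X alpha w b ((1 - t) *: dlt)).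
pose ut t := Psi X (vt t) w + Amul b.
have W_le l : l2norm (Wmx w l) <= M.
  exact: weight_bound (le_trans (Ob_le_O _ _ _ _ feas) (ltW Olt)).
have S0 := blocknorm_ge0 dlt; set S := blocknorm dlt in S0 *.
have bn s t : blocknorm ((1 - s) *: dlt - (1 - t) *: dlt) = `|t - s| * S.
  by rewrite -scalerBl blocknormZ; congr (`|_| * _); ring.
have M0 : 0 <= M := le_trans ler01 M_ge1.
have dist_v s t : l2norm (vt s - vt t) <= `|t - s| * (L%:R * M ^+ L * S).
  apply: (le_trans (propagation_dist X alpha alpha_gt0 alpha_lt1 w b M M_ge1 W_le
     _ _ _ _ (vtE s) (vtE t))).
  by rewrite bn mulrCA.
have vE : v = step X alpha w b ((1 - 0) *: dlt) v.
  by rewrite subr0 scale1r /step -uE /dlt addrC subrK.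
have v0E : vt 0 = v.
  apply/eqP; rewrite -subr_eq0 -normr_eq0 eq_le normr_ge0 andbT.
  apply: le_trans (mx_norm_le_l2norm _) _.
  apply: (le_trans (propagation_dist X alpha alpha_gt0 alpha_lt1 w b M M_ge1 W_le
     _ _ _ _ (vtE 0) vE)).
  by rewrite bn subrr normr0 mul0r mulr0.
have defect t : vt t - lrelu alpha (ut t) = (1 - t) *: dlt.
  by rewrite {1}vtE /step addrC addKr.
have feasible t : t <= 1 -> Omega2 X alpha (w, b, vt t, ut t).
  move=> t1; apply/Omega2P; split=> // i.
  by rewrite defect mxE mulr_ge0 // subr_ge0.
pose f t := O w (vt t) (ut t).
have fE t : f t = Ob w (vt t) + (1 - t) * penalty dlt.
  by rewrite /f OE defect penaltyZ.
have f0E : f 0 = O w v u by rewrite /f /ut v0E -uE.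
(* [C] bounds the speed, and hence also the length, of the path. *)
pose C := L%:R * M ^+ L * S.
have C0 : 0 <= C by rewrite !mulr_ge0 ?exprn_ge0.
have col0 s t : l2norm (col_mx (w - w) (vt t - vt s)) = l2norm (vt t - vt s).
  by apply: eq_l2norm; rewrite l2norm_col_mx subrr l2norm0 expr0n add0r.
have [K K0 KP] := Obar_lipschitz X Y lambda_w lambda_v (l2norm v + C)
  (ltW lambda_w_gt0) (ltW lambda_v_gt0) (addr_ge0 (l2norm_ge0 _) C0).
have bounded t : 0 <= t -> t <= 1 -> l2norm (vt t) <= l2norm v + C.
  move=> t0 t1; rewrite -[vt t](subrK v) addrC.
  apply: le_trans (ler_l2normD _ _) _; rewrite lerD2l -v0E.
  apply: le_trans (dist_v _ _) _.
  by rewrite sub0r normrN ger0_norm // ler_piMl.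
have rateE : repair_rate dlt = penalty dlt - Lip * C by [].
have trade_off (a a' p l c s t : R) : a - a' <= l * ((t - s) * c) ->
  a + (1 - t) * p <= a' + (1 - s) * p - (t - s) * (p - l * c) by lra.
have pen0 := penalty_ge0 _ dlt0.
have descent := sublevel_descent f (K * C) (repair_rate dlt) theta rate0.
rewrite f0E in descent.
have {descent} descent : forall t, 0 <= t -> t <= 1 ->
    f t <= O w v u - t * repair_rate dlt.
  apply: descent => // s t s0 st t1.
  (* The coarse bound, with a Lipschitz constant [K] valid on a ball that contains
     the whole path, does not need the path to stay below [theta]; only the fine
     bound that follows does. *)
  - have H : `|Ob w (vt t) - Ob w (vt s)| <= K * ((t - s) * C).
      apply: le_trans (KP w (vt t) w (vt s) (bounded _ _ t1) (bounded _ s0 _)) _.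
      + exact: le_trans st.
      + exact: le_trans t1.
      rewrite col0 ler_wpM2l //; apply: le_trans (dist_v _ _) _.
      by rewrite distrC ger0_norm // subr_ge0.
    have {}H := le_trans (ler_norm _) H.
    have : 0 <= (t - s) * penalty dlt by rewrite mulr_ge0 // subr_ge0.
    by rewrite !fE; lra.
  - move=> fs ft.
    have H : `|Ob w (vt t) - Ob w (vt s)| <= Lip * ((t - s) * C).
      apply: (le_trans (LipObar_lipschitz w b (vt t) (ut t) w b (vt s) (ut s)
        (conj (feasible t t1) ft) (conj (feasible s (le_trans st t1)) fs))).
      rewrite col0 ler_wpM2l ?LipObar_ge0 //; apply: le_trans (dist_v _ _) _.
      by rewrite distrC ger0_norm // subr_ge0.
    have {}H := le_trans (ler_norm _) H.
    rewrite !fE rateE; exact: trade_off.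
move=> t t0 t1; exists (vt t), (ut t); split=> //.
- exact: feasible.
- exact: descent.
- rewrite -{1}v0E; apply: le_trans (dist_v _ _) _.
  rewrite subr0 ger0_norm // ler_wpM2l // ler_wpM2r // ler_wpM2l //.
  by rewrite exprS ler_peMl ?exprn_ge0 ?M_ge1.
- rewrite uE /ut opprD addrACA subrr addr0 -{1}v0E.
  apply: (le_trans (preactivation_dist X alpha alpha_gt0 alpha_lt1 w b M M_ge1 W_le
     _ _ _ _ (vtE 0) (vtE t))).
  by rewrite bn subr0 ger0_norm // mulrCA.
Qed.

Section LargePenalty.
Hypothesis beta_large : forall l : nat, (1 <= l <= L)%N ->
  L%:R * Lip * M ^+ L < beta l.

Lemma repair_rate_ge0 dlt : (forall i, 0 <= dlt i 0) -> 0 <= repair_rate dlt.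
Proof.
move=> dlt0; rewrite subr_ge0; apply: le_trans _ (penalty_ge_blocks dlt dlt0).
rewrite /blocknorm !mulrA (mulrC Lip) mulr_sumr; apply: ler_sum => l _.
by rewrite ler_wpM2r ?l2norm_ge0 // ltW // beta_large // ltn_ord.
Qed.

Lemma repair_rate_gt0 dlt :
  (forall i, 0 <= dlt i 0) -> dlt != 0 -> 0 < repair_rate dlt.
Proof.
move=> dlt0 nz; rewrite subr_gt0; apply: lt_le_trans _ (penalty_ge_blocks dlt dlt0).
have /existsP[l nzl] : [exists l, submxcol dlt l != 0].
  apply: contraNT nz; rewrite negb_exists => /forallP z; apply/eqP/mxcolP => l.
  by rewrite submxcol0; apply/eqP; rewrite -[_ == _]negbK z.
rewrite /blocknorm !mulrA (mulrC Lip) mulr_sumr.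
rewrite (bigD1 l) //= [ltRHS](bigD1 l) //=; apply: ltr_leD.
  rewrite ltr_pM2r ?beta_large ?ltn_ord //.
  rewrite (lt_le_trans _ (mx_norm_le_l2norm _)) // normr_gt0 //.
apply: ler_sum => k _.
by rewrite ler_wpM2r ?l2norm_ge0 // ltW // beta_large // ltn_ord.
Qed.

(** The path followed to its end. The distance bounds matter for local
    minimality: if the defect is small, the repaired point is close. *)
Lemma repair w b v u :
  Omega2 X alpha (w, b, v, u) -> O w v u < theta ->
  exists v' u',
    [/\ Omega1 X alpha (w, b, v', u'), Ob w v' <= O w v u,
        l2norm (v - v') <= L%:R * M ^+ L.+1 * blocknorm (v - lrelu alpha u)
      & l2norm (u - u') <= L%:R * M ^+ L.+1 * blocknorm (v - lrelu alpha u)].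
Proof.
move=> feas Olt; have [uE dlt0] := proj1 (Omega2P _ _ _ _) feas.
have rate0 := repair_rate_ge0 _ dlt0.
have [v' [u' [feas' E le_O]]] := repair_path _ _ _ _ feas Olt rate0 1 ler01 (lexx 1).
rewrite !mul1r => dv du; exists v', u'; split=> //.
  by apply/Omega1P; rewrite E subrr scale0r.
apply: le_trans (Ob_le_O _ _ _ _ feas') _; apply: le_trans le_O _.
by rewrite mul1r gerBl.
Qed.

(** The path followed for a time so short that it stays within distance [e]. *)
Lemma infeasible_descent w b v u (e : R) :
  Omega2 X alpha (w, b, v, u) -> O w v u < theta ->
  v - lrelu alpha u != 0 -> 0 < e ->
  exists v' u', [/\ Omega2 X alpha (w, b, v', u'), O w v' u' < O w v u,
    l2norm (v - v') < e & l2norm (u - u') < e].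
Proof.
move=> feas Olt nz e0; have [uE dlt0] := proj1 (Omega2P _ _ _ _) feas.
have rate0 := repair_rate_gt0 _ dlt0 nz.
set dlt := v - lrelu alpha u in nz dlt0 rate0 *.
set c := L%:R * M ^+ L.+1 * blocknorm dlt.
have c0 : 0 <= c.
  by rewrite !mulr_ge0 ?blocknorm_ge0 ?exprn_ge0 // (le_trans ler01 M_ge1).
pose t := Num.min 1 (e / (c + 1)).
have c1 : 0 < c + 1 by rewrite ltr_wpDl.
have t0 : 0 < t by rewrite lt_min ltr01 divr_gt0.
have t1 : t <= 1 by rewrite ge_min lexx.
have tc : t * c < e.
  have : t * (c + 1) <= e by rewrite -ler_pdivlMr // ge_min lexx orbT.
  by lra.
have [v' [u' [feas' _ le_O dv du]]] := repair_path _ _ _ _ feas Olt (ltW rate0) t (ltW t0) t1.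
exists v', u'; split=> //.
- by apply: le_lt_trans le_O _; rewrite gtrBl mulr_gt0.
- exact: le_lt_trans dv tc.
- exact: le_lt_trans du tc.
Qed.

End LargePenalty.
End Repair.

(** * Minimizers of the two problems *)

Lemma near_varsP {R : realType} {L N : nat} {d : nat -> nat}
    (w : 'cV[R]_(wdim L d)) (b : 'cV[R]_(bdim L d)) (v u : 'cV[R]_(vdim L N d))
    (P : vars R L N d -> Prop) :
  (\forall z' \near ((w, b, v, u) : vars R L N d), P z') <->
  exists2 e : R, 0 < e & forall w' b' v' u',
    `|w - w'| < e -> `|b - b'| < e -> `|v - v'| < e -> `|u - u'| < e ->
    P (w', b', v', u').
Proof.
split.
  move=> /nbhs_ballP[e /= e0 H]; exists e => // w' b' v' u' hw hb hv hu.
  by apply: H; split; [split; [split|]|]; rewrite -ball_normE.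
move=> [e e0 H]; apply/nbhs_ballP; exists e => //= -[[[w' b'] v'] u'].
by move=> [[[hw hb] hv] hu]; apply: H; [move: hw|move: hb|move: hv|move: hu];
   rewrite -ball_normE.
Qed.

Section Origin.
Context {R : realType} {L N : nat} {d : nat -> nat}.
Context (X : 'M[R]_(d 0%N, N)) (Y : 'M[R]_(d L, N)).

Lemma Vmx_zero (k : 'I_L.+1) : (0 < k)%N -> Vmx X (0 : 'cV[R]_(vdim L N d)) k = 0.
Proof.
case: k => -[|k] hk // _.
by rewrite VmxS submxcol0 /uncvec !linear0.
Qed.

Lemma lrelu0 (alpha : R) p q : lrelu alpha (0 : 'M[R]_(p, q)) = 0.
Proof. by apply/matrixP => i j; rewrite !mxE mulr0 maxxx. Qed.

Lemma Wmx0 l : Wmx (0 : 'cV[R]_(wdim L d)) l = 0.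
Proof. by rewrite /Wmx submxcol0 /uncvec !linear0. Qed.

Lemma origin_Omega1 alpha : Omega1 X alpha ((0, 0, 0, 0) : vars R L N d).
Proof.
split; first by rewrite lrelu0.
apply/mxcolP => l; rewrite submxcolD submxcol_Psi mxcolK Wmx0 mul0mx.
by rewrite /bvec !submxcol0 mul0mx /cvec !linear0 addr0.
Qed.

Lemma objP_origin lambda_w lambda_v : (0 < L)%N ->
  objP X Y lambda_w lambda_v ((0, 0, 0, 0) : vars R L N d)
  = N%:R^-1 * l2norm Y ^+ 2.
Proof.
move=> L0; rewrite /objP /Obar sum_sqr_col_dist.
have -> : R1 lambda_w (0 : 'cV[R]_(wdim L d)) = 0.
  rewrite /R1 big1 ?mulr0 // => l _; apply: big1 => j _.
  by rewrite Wmx0 linear0 l2norm0.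
rewrite /R2 l2norm0 expr0n mulr0 !addr0.
by rewrite (Vmx_zero ord_max L0) sub0r l2normN.
Qed.

End Origin.

(** The defect is a Lipschitz function of [(v, u)], here compared with a point
    where it vanishes. *)
Lemma blocknorm_defect_near {R : realType} {L N : nat} {d : nat -> nat}
    (alpha e : R) (v u v' u' : 'cV[R]_(vdim L N d)) :
  0 < alpha -> alpha < 1 -> v - lrelu alpha u = 0 ->
  `|v - v'| <= e -> `|u - u'| <= e ->
  blocknorm (v' - lrelu alpha u') <= L%:R * (2 * (vdim L N d)%:R) * e.
Proof.
move=> a0 a1 E dv du; apply: le_trans (blocknorm_le_l2norm _) _.
rewrite -mulrA ler_wpM2l //.
have -> : v' - lrelu alpha u' = - (v - v') + (lrelu alpha u - lrelu alpha u').
  by rewrite -(subr0_eq E) opprB addrA subrK.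
apply: le_trans (ler_l2normD _ _) _; rewrite l2normN.
rewrite -mulrA mulrDl mul1r; apply: lerD.
  by apply: le_trans (l2norm_le_mx_norm _) _; rewrite ler_wpM2l.
apply: le_trans (l2norm_lrelu_dist _ _ _ a0 a1) _.
by apply: le_trans (l2norm_le_mx_norm _) _; rewrite ler_wpM2l.
Qed.

Theorem theorem10 (R : realType) (L N : nat) (d : nat -> nat)
  (L_gt0 : (0 < L)%N) (N_gt0 : (0 < N)%N)
  (d_gt0 : forall l : nat, (l <= L)%N -> (0 < d l)%N)
  (X : 'M[R]_(d 0%N, N)) (Y : 'M[R]_(d L, N))
  (alpha lambda_w lambda_v : R) (beta : nat -> R) (theta : R)
  (alpha_gt0 : 0 < alpha) (alpha_lt1 : alpha < 1)
  (lambda_w_gt0 : 0 < lambda_w) (lambda_v_gt0 : 0 < lambda_v)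
  (beta_gt0 : forall l : nat, (1 <= l <= L)%N -> 0 < beta l)
  (theta_gt : N%:R^-1 * l2norm Y ^+ 2 < theta)
  (beta_large : forall l : nat, (1 <= l <= L)%N ->
     L%:R * LipObar X Y alpha lambda_w lambda_v beta theta
       * Num.max (theta_w L d lambda_w theta) 1 ^+ L
     + 2 * \sum_(l.+1 <= j < L.+1)
             beta j * theta_w L d lambda_w theta
               * Num.max (theta_w L d lambda_w theta) 1 ^+ (j - l - 1)%N
     < beta l) :
  [/\ forall z : vars R L N d,
        global_minimizer (objPP X Y alpha lambda_w lambda_v beta)
          (Omega2 X alpha) z
        <-> global_minimizer (objP X Y lambda_w lambda_v) (Omega1 X alpha) z,
      forall z : vars R L N d,
        Omega2 X alpha z ->
        objPP X Y alpha lambda_w lambda_v beta z < theta ->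
        local_minimizer (objPP X Y alpha lambda_w lambda_v beta)
          (Omega2 X alpha) z ->
        local_minimizer (objP X Y lambda_w lambda_v) (Omega1 X alpha) z
    & forall z : vars R L N d,
        Omega1 X alpha z ->
        objPP X Y alpha lambda_w lambda_v beta z < theta ->
        (local_minimizer (objP X Y lambda_w lambda_v) (Omega1 X alpha) z
         <-> local_minimizer (objPP X Y alpha lambda_w lambda_v beta)
               (Omega2 X alpha) z)].
Proof.
have theta_gt0 : 0 < theta.
  by apply: le_lt_trans theta_gt; rewrite mulr_ge0 ?invr_ge0 ?sqr_ge0.
have d0_gt0 : (0 < d 0)%N by exact: d_gt0.
have tw0 : 0 <= theta_w L d lambda_w theta.
  rewrite /theta_w mulr_ge0 ?sqrtr_ge0 //.
  by apply: divr_ge0; apply: ltW.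
have big l : (1 <= l <= L)%N ->
    L%:R * LipObar X Y alpha lambda_w lambda_v beta theta
      * Num.max (theta_w L d lambda_w theta) 1 ^+ L < beta l.
  move=> /[dup] /andP[l1 lL] /beta_large; apply: le_lt_trans.
  rewrite lerDl mulr_ge0 // big_nat_cond; apply: sumr_ge0 => j.
  rewrite andbT => /andP[lj jL].
  have bj0 : 0 <= beta j by apply/ltW/beta_gt0; rewrite (leq_ltn_trans _ lj).
  apply: mulr_ge0; first exact: mulr_ge0.
  by rewrite exprn_ge0 // le_max ler01 orbT.
have fix_it := @repair R L N d X Y alpha lambda_w lambda_v beta theta d0_gt0
  alpha_gt0 alpha_lt1 lambda_w_gt0 lambda_v_gt0 beta_gt0 theta_gt0 big.
have descend := @infeasible_descent R L N d X Y alpha lambda_w lambda_v beta theta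
  d0_gt0 alpha_gt0 alpha_lt1 lambda_w_gt0 lambda_v_gt0 beta_gt0 theta_gt0 big.
have agree := @objPP_Omega1 R L N d X Y alpha lambda_w lambda_v beta.
have Omega12 (z : vars R L N d) : Omega1 X alpha z -> Omega2 X alpha z.
  by case: z => [[[w b] v] u] /Omega1P[].
have origin1 : Omega1 X alpha ((0, 0, 0, 0) : vars R L N d) by exact: origin_Omega1.
have origin_lt : objP X Y lambda_w lambda_v ((0, 0, 0, 0) : vars R L N d) < theta.
  by rewrite objP_origin.
(* A point that violates the network equations is improved arbitrarily close
   to itself, so it minimizes not even locally. *)
have local_feasible (z : vars R L N d) : objPP X Y alpha lambda_w lambda_v beta z < theta ->
    local_minimizer (objPP X Y alpha lambda_w lambda_v beta) (Omega2 X alpha) z ->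
    Omega1 X alpha z.
  case: z => [[[w b] v] u] Olt [feas /near_varsP[e e0 H]].
  apply/Omega1P; split=> //; apply/eqP; apply: contraT => nz.
  have [v' [u' [feas' lt_O dv du]]] := descend w b v u e feas Olt nz e0.
  have := H w b v' u'; rewrite !subrr !normr0.
  move=> /(_ e0 e0 (le_lt_trans (mx_norm_le_l2norm _) dv)).
  move=> /(_ (le_lt_trans (mx_norm_le_l2norm _) du) feas').
  by rewrite leNgt lt_O.
have localPP_P (z : vars R L N d) : Omega1 X alpha z ->
    local_minimizer (objPP X Y alpha lambda_w lambda_v beta) (Omega2 X alpha) z ->
    local_minimizer (objP X Y lambda_w lambda_v) (Omega1 X alpha) z.
  move=> feas [_ H]; split=> //; apply: filterS H => z' H feas'.
  by rewrite -!agree //; apply: H; exact: Omega12.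
split.
- move=> z; split=> [[feas H]|[feas H]].
  + have Olt : objPP X Y alpha lambda_w lambda_v beta z < theta.
      have := H _ (Omega12 _ origin1); rewrite [X in _ <= X]agree // => le_o.
      exact: le_lt_trans le_o origin_lt.
    have feas1 : Omega1 X alpha z.
      apply: local_feasible => //; split=> //; case: z H {feas Olt} => [[[w b] v] u] H.
      by apply/near_varsP; exists 1 => // w' b' v' u' _ _ _ _; exact: H.
    by split=> // z' feas'; rewrite -!agree //; apply: H; exact: Omega12.
  + split=> [|z' feas']; first exact: Omega12.
    rewrite agree //; have [lt_th|le_th] := ltP (objPP X Y alpha lambda_w lambda_v beta z') theta.
      case: z' feas' lt_th => [[[w b] v] u] feas' lt_th.
      have [v' [u' [feas1 le_O _ _]]] := fix_it w b v u feas' lt_th.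
      exact: le_trans (H _ feas1) le_O.
    by apply: le_trans (ltW (lt_le_trans origin_lt le_th)); exact: H.
- by move=> z feas Olt loc; apply: localPP_P => //; exact: local_feasible.
move=> z feas Olt; split; last exact: localPP_P.
case: z feas Olt => [[[w b] v] u] feas Olt [_ /near_varsP[e e0 H]].
split; first exact: Omega12.
have [_ defect0] := proj1 (Omega1P _ _ _ _ _ _) feas.
(* Around a feasible point, a competitor at distance [r] is repaired within
   distance [C * r] of itself. *)
pose C := L%:R * Num.max (theta_w L d lambda_w theta) 1 ^+ L.+1
          * (L%:R * (2 * (vdim L N d)%:R)).
have C0 : 0 <= C by rewrite !mulr_ge0 ?exprn_ge0 ?le_max ?ler01 ?orbT.
have C1 : 0 < 1 + C by rewrite ltr_wpDr.
apply/near_varsP; exists (e / (1 + C)); first by rewrite divr_gt0.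
set r := e / (1 + C) => w' b' v' u' hw hb hv hu feas'.
have rE : r * (1 + C) = e by rewrite divfK ?gt_eqF.
have r0 : 0 < r by rewrite divr_gt0.
have re : r <= e by rewrite -rE (ler_peMr (ltW r0)) // lerDl.
have [lt_th|le_th] := ltP (objPP X Y alpha lambda_w lambda_v beta (w', b', v', u')) theta;
  last exact: ltW (lt_le_trans Olt le_th).
have [v2 [u2 [feas2 le_O dv du]]] := fix_it w' b' v' u' feas' lt_th.
have small : L%:R * Num.max (theta_w L d lambda_w theta) 1 ^+ L.+1
    * blocknorm (v' - lrelu alpha u') <= C * r.
  rewrite /C -[leRHS]mulrA ler_wpM2l ?mulr_ge0 ?exprn_ge0 ?le_max ?ler01 ?orbT //.
  exact: blocknorm_defect_near alpha_gt0 alpha_lt1 defect0 (ltW hv) (ltW hu).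
have close (x x' x2 : 'cV[R]_(vdim L N d)) : `|x - x'| < r ->
    l2norm (x' - x2) <= C * r -> `|x - x2| < e.
  move=> h h2; rewrite -rE mulrDr mulr1 (mulrC r C).
  have -> : x - x2 = (x - x') + (x' - x2) by rewrite addrA subrK.
  apply: le_lt_trans (ler_normD _ _) _; apply: ltr_leD => //.
  exact: le_trans (mx_norm_le_l2norm _) h2.
rewrite agree //.
apply: le_trans le_O; apply: (H w' b' v2 u2) => //.
- exact: lt_le_trans hw re.
- exact: lt_le_trans hb re.
- exact: close hv (le_trans dv small).
- exact: close hu (le_trans du small).
Qed.
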